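(* $K_3\cong F[S^2]_3$ and $K_4\cong F[S^2]_4$ (isomorphisms of groups).
   Context: For $n\ge 2$ the twin group $T_n$ is generated by $t_1,\dots,t_{n-1}$ with relations $t_i^2=1$ and $t_it_j=t_jt_i$ for $|i-j|\ge 2$; $T_1$ is trivial. Geometrically its elements (twins) are homotopy classes of configurations of $n$ monotone strands in $\mathbb R\times[0,1]$ joining $n$ marked points on $y=1$ to $n$ marked points on $y=0$, with no three strands through a common point; the product is stacking (left factor on top), and $t_i$ is the single crossing of the strands in positions $i,i+1$. For $u\in T_n$ let $\nu(u)\in S_n$ be the permutation such that the strand starting at position $k$ ends at position $\nu(u)(k)$. The pure twin group $PT_n$ is the subgroup of all $u$ with $\nu(u)=1$. Put $SPT_n=PT_{n+1}$ for $n\ge0$. For $0\le i\le n$ the degeneracy homomorphism $s_i:SPT_n=PT_{n+1}\to SPT_{n+1}=PT_{n+2}$ doubles the $(i+1)$-th strand (replaces it by two parallel non-crossing copies). Explicitly, doubling is determined on all of $T_{n+1}$ by $s_i(uw)=s_i(u)\,s_{\nu(u)(i+1)-1}(w)$ and $s_i(t_j)=t_{j+1}$ if $i+1<j$, $s_i(t_j)=t_{j+1}t_j$ if $i+1=j$, $s_i(t_j)=t_jt_{j+1}$ if $i+1=j+1$, $s_i(t_j)=t_j$ if $i+1>j+1$. Let $c_{111}=(t_1t_2)^3\in PT_3=SPT_2$. For $n\ge 2$, $K_n$ is the subgroup of $SPT_n=PT_{n+1}$ generated by the $n(n-1)/2$ elements $$s_{n-1}\cdots s_{j+1}\widehat{s_j}s_{j-1}\cdots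 s_{i+1}\widehat{s_i}s_{i-1}\cdots s_0(c_{111}),\qquad 0\le i<j\le n-1,$$ where $\widehat{s_k}$ means that $s_k$ is omitted. In particular $K_3=\langle s_0(c_{111}),s_1(c_{111}),s_2(c_{111})\rangle\le PT_4$ and $K_4=\langle s_1s_0(c_{111}),s_2s_0(c_{111}),s_3s_0(c_{111}),s_2s_1(c_{111}),s_3s_1(c_{111}),s_3s_2(c_{111})\rangle\le PT_5$. $F[S^2]_*$ is Milnor's $F[K]$ construction on the pointed simplicial $2$-sphere $S^2=\Delta[2]/\partial\Delta[2]$ with non-degenerate $2$-simplex $\sigma$: $F[S^2]_n$ is the free group on the $n$-simplices other than the basepoint, i.e. on the $n(n-1)/2$ elements $x_{ij}=s_{n-1}\cdots\widehat{s_j}\cdots\widehat{s_i}\cdots s_0(\sigma)$, $0\le i<j\le n-1$. Thus $F[S^2]_3$ is free of rank $3$ and $F[S^2]_4$ is free of rank $6$. *)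

(* Defs.v *)
From HB Require Import structures.
From mathcomp Require Import all_boot perm.
From mathcomp Require Import boolp.
From mathcomp Require Import zify.

Set Implicit Arguments.
Unset Strict Implicit.
Unset Printing Implicit Defensive.

Local Open Scope group_scope.
Local Open Scope quotient_scope.

Definition isomorphic (G H : groupType) : Prop :=
  exists f : {multiplicative G -> H}, bijective f.

(* The letter (x, true) stands for x and (x, false) for x^-1. *)
Definition word (X : Type) := seq (X * bool).

Inductive pres_eq (X : Type) (R : word X -> word X -> Prop) :
    word X -> word X -> Prop :=
| pres_refl u : pres_eq R u u
| pres_sym u v : pres_eq R u v -> pres_eq R v u
| pres_trans u v w : pres_eq R u v -> pres_eq R v w -> pres_eq R u w
| pres_cat u u' v v' :
    pres_eq R u u' -> pres_eq R v v' -> pres_eq R (u ++ v) (u' ++ v')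
| pres_cancel x b : pres_eq R [:: (x, b); (x, ~~ b)] [::]
| pres_rel u v : R u v -> pres_eq R u v.

Section Presentation.
Variables (X : choiceType) (R : word X -> word X -> Prop).

Definition pres_eqb : rel (word X) := fun u v => `[< pres_eq R u v >].

Lemma pres_eqb_refl : reflexive pres_eqb.
Proof. by move=> u; apply/asboolP; apply: pres_refl. Qed.

Lemma pres_eqb_sym : symmetric pres_eqb.
Proof. by move=> u v; apply/asboolP/asboolP; apply: pres_sym. Qed.

Lemma pres_eqb_trans : transitive pres_eqb.
Proof.
by move=> v u w /asboolP uv /asboolP vw; apply/asboolP; apply: pres_trans vw.
Qed.

Canonical pres_equiv :=
  EquivRel pres_eqb pres_eqb_refl pres_eqb_sym pres_eqb_trans.

(* The group < X | u = v for (u, v) in R >. *)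
Definition pres : Type := {eq_quot pres_equiv}.
HB.instance Definition _ := Choice.on pres.
HB.instance Definition _ := EqQuotient.on pres.

Definition pres_cls (u : word X) : pres := \pi u.

Lemma pres_clsP u v : pres_cls u = pres_cls v <-> pres_eq R u v.
Proof.
split; first by move/eqmodP/asboolP.
by move=> uv; apply/eqmodP/asboolP.
Qed.

Lemma pres_reprK u : pres_eq R (repr (pres_cls u)) u.
Proof. by apply/pres_clsP; apply: reprK. Qed.

Definition word_inv (u : word X) : word X := rev [seq (l.1, ~~ l.2) | l <- u].

Lemma word_inv_cat u v : word_inv (u ++ v) = word_inv v ++ word_inv u.
Proof. by rewrite /word_inv map_cat rev_cat. Qed.

Lemma word_invK : involutive word_inv.
Proof.
move=> u; rewrite /word_inv map_rev revK -map_comp -[RHS]map_id.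
by apply: eq_map => -[x b] /=; rewrite negbK.
Qed.

Lemma word_invr u : pres_eq R (u ++ word_inv u) [::].
Proof.
elim: u => [|[x b] u IHu]; first exact: pres_refl.
rewrite -cat1s word_inv_cat -[_ ++ _]catA [u ++ _]catA.
apply: pres_trans (pres_cancel R x b).
rewrite -[[:: (x, b); _]]/([:: (x, b)] ++ ([::] ++ [:: (x, ~~ b)])).
by apply: pres_cat (pres_refl _ _) (pres_cat IHu (pres_refl _ _)).
Qed.

Lemma word_invl u : pres_eq R (word_inv u ++ u) [::].
Proof. by rewrite -{2}[u]word_invK; apply: word_invr. Qed.

Lemma word_inv_eq u v : pres_eq R u v -> pres_eq R (word_inv u) (word_inv v).
Proof.
move=> uv; apply: (@pres_trans _ _ _ (word_inv u ++ (v ++ word_inv v))).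
  rewrite -[X in pres_eq R X]cats0; apply: pres_cat (pres_refl _ _) _.
  exact/pres_sym/word_invr.
rewrite catA -[X in pres_eq R _ X]cat0s; apply: pres_cat (pres_refl _ _).
apply: pres_trans (word_invl u).
exact: pres_cat (pres_refl _ _) (pres_sym uv).
Qed.

Definition pres_mul (a b : pres) : pres := pres_cls (repr a ++ repr b).
Definition pres_one : pres := pres_cls [::].
Definition pres_inv (a : pres) : pres := pres_cls (word_inv (repr a)).

Lemma pres_cls_cat u v : pres_cls (u ++ v) = pres_mul (pres_cls u) (pres_cls v).
Proof. by apply/pres_clsP/pres_sym/pres_cat; apply: pres_reprK. Qed.

Lemma pres_cls_inv u : pres_cls (word_inv u) = pres_inv (pres_cls u).
Proof. by apply/pres_clsP/pres_sym/word_inv_eq/pres_reprK. Qed.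

Lemma pres_ind (P : pres -> Prop) : (forall u, P (pres_cls u)) -> forall a, P a.
Proof. by move=> Pcls a; rewrite -[a]reprK; apply: Pcls. Qed.

Lemma pres_mulA : associative pres_mul.
Proof.
by elim/pres_ind=> u; elim/pres_ind=> v; elim/pres_ind=> w;
  rewrite -!pres_cls_cat catA.
Qed.

Lemma pres_mul1g : left_id pres_one pres_mul.
Proof. by elim/pres_ind=> u; rewrite -pres_cls_cat. Qed.

Lemma pres_mulg1 : right_id pres_one pres_mul.
Proof. by elim/pres_ind=> u; rewrite -pres_cls_cat cats0. Qed.

Lemma pres_mulVg : left_inverse pres_one pres_inv pres_mul.
Proof.
elim/pres_ind=> u; rewrite -pres_cls_inv -pres_cls_cat.
exact/pres_clsP/word_invl.
Qed.

Lemma pres_mulgV : right_inverse pres_one pres_inv pres_mul.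
Proof.
elim/pres_ind=> u; rewrite -pres_cls_inv -pres_cls_cat.
exact/pres_clsP/word_invr.
Qed.

HB.instance Definition _ := isGroup.Build pres
  pres_mulA pres_mul1g pres_mulg1 pres_mulVg pres_mulgV.

Definition pres_gen (x : X) : pres := pres_cls [:: (x, true)].

Lemma pres_clsM u v : pres_cls (u ++ v) = pres_cls u * pres_cls v.
Proof. exact: pres_cls_cat. Qed.

Lemma pres_cls0 : pres_cls [::] = 1.
Proof. by []. Qed.

Lemma pres_cls1 x b :
  pres_cls [:: (x, b)] = if b then pres_gen x else (pres_gen x)^-1.
Proof. by case: b => //; rewrite /pres_gen -[RHS]pres_cls_inv. Qed.

Section Lift.
Variables (G : groupType) (f : X -> G).

Fixpoint word_eval (u : word X) : G :=
  if u is (x, b) :: u' then (if b then f x else (f x)^-1) * word_eval u' else 1.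

Lemma word_eval_cat u v : word_eval (u ++ v) = word_eval u * word_eval v.
Proof. by elim: u => [|[x b] u IHu] /=; rewrite ?mul1g // IHu mulgA. Qed.

Hypothesis fR : forall u v, R u v -> word_eval u = word_eval v.

Lemma word_eval_eq u v : pres_eq R u v -> word_eval u = word_eval v.
Proof.
elim=> // [{}u {}v w _ -> //|{}u u' {}v v' _ uu' _ vv'|x b].
  by rewrite !word_eval_cat uu' vv'.
by case: b => /=; rewrite mulg1 ?mulgV ?mulVg.
Qed.

Definition pres_lift (a : pres) : G := word_eval (repr a).

Lemma pres_lift_cls u : pres_lift (pres_cls u) = word_eval u.
Proof. exact/word_eval_eq/pres_reprK. Qed.

Lemma pres_liftM a b : pres_lift (a * b) = pres_lift a * pres_lift b.
Proof.
elim/pres_ind: a => u; elim/pres_ind: b => v.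
by rewrite -pres_clsM !pres_lift_cls word_eval_cat.
Qed.

Lemma pres_lift_gen x : pres_lift (pres_gen x) = f x.
Proof. by rewrite pres_lift_cls /= mulg1. Qed.

End Lift.

End Presentation.

Definition free_group (X : choiceType) : groupType :=
  pres (fun _ _ : word X => False).

Section Generated.
Variables (G : groupType) (S : G -> Prop).

Definition gen_mem : pred G := fun x =>
  `[< forall H : {pred G}, group_closed H -> (forall y, S y -> y \in H) ->
      x \in H >].

Lemma gen_mem_closed : group_closed gen_mem.
Proof.
split=> [|x y /asboolP Sx /asboolP Sy]; apply/asboolP=> H HG SH.
  by case: HG.
by case: (HG) => _; apply; [apply: Sx | apply: Sy].
Qed.

Definition generated : Type := {x : G | gen_mem x}.
HB.instance Definition _ := SubChoice.on generated.
HB.instance Definition _ :=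
  SubChoice_isSubGroup.Build G gen_mem generated gen_mem_closed.

End Generated.

(* The generator t_j (1 <= j <= n - 1) is indexed by the ordinal j - 1. *)
Inductive twin_rel (n : nat) : word 'I_n.-1 -> word 'I_n.-1 -> Prop :=
| twin_sq (i : 'I_n.-1) : twin_rel [:: (i, true); (i, true)] [::]
| twin_comm (i j : 'I_n.-1) : (i.+2 <= j) || (j.+2 <= i) ->
    twin_rel [:: (i, true); (j, true)] [:: (j, true); (i, true)].

(* T_n (for n = 0 this is also the trivial group) *)
Definition twin (n : nat) : groupType := pres (@twin_rel n).

Definition twin_gen (n : nat) (j : 'I_n.-1) : twin n :=
  pres_gen (@twin_rel n) j.

Lemma twin_gen_sq n (j : 'I_n.-1) : twin_gen j * twin_gen j = 1.
Proof. by rewrite -pres_clsM; apply/pres_clsP/pres_rel/twin_sq. Qed.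

Lemma twin_genV n (j : 'I_n.-1) : (twin_gen j)^-1 = twin_gen j.
Proof. by rewrite -[RHS](mulKg (twin_gen j)) twin_gen_sq mulg1. Qed.

Lemma twin_genC n (i j : 'I_n.-1) : (i.+2 <= j) || (j.+2 <= i) ->
  twin_gen i * twin_gen j = twin_gen j * twin_gen i.
Proof. by move=> ij; rewrite -!pres_clsM; apply/pres_clsP/pres_rel/twin_comm. Qed.

Lemma ltn_pred0 n (j : 'I_n.-1) : j < n.
Proof. by case: n j => [[]|n j] //=; apply: ltnW; rewrite ltnS. Qed.

Lemma ltn_pred1 n (j : 'I_n.-1) : j.+1 < n.
Proof. by case: n j => [[]|n j] //=; rewrite ltnS. Qed.

Definition adj_tperm (n : nat) (j : 'I_n.-1) : 'S_n :=
  tperm (Ordinal (ltn_pred0 j)) (Ordinal (ltn_pred1 j)).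

Definition swap_nat (j k : nat) : nat :=
  if k == j then j.+1 else if k == j.+1 then j else k.

Lemma adj_tpermE n (j : 'I_n.-1) (k : 'I_n) :
  adj_tperm j k = swap_nat j k :> nat.
Proof.
rewrite /adj_tperm /swap_nat permE /=.
by rewrite -!val_eqE /=; do 2?case: ifP.
Qed.

Lemma adj_tperm_rel n u v : @twin_rel n u v ->
  word_eval (@adj_tperm n) u = word_eval (@adj_tperm n) v.
Proof.
case=> [i|i j ij] /=; first by rewrite mulg1 tperm2.
rewrite !mulg1; apply/permP=> k; apply: val_inj; rewrite !permM /= !adj_tpermE.
by rewrite /swap_nat; repeat case: eqP => //; lia.
Qed.

(* nu (u * v) k = nu v (nu u k): the strands of u are followed first, which is
   also the convention for products of permutations in 'S_n. *)
Definition nu (n : nat) : twin n -> 'S_n := pres_lift (@adj_tperm n).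

Lemma nuM n (u v : twin n) : nu (u * v) = nu u * nu v.
Proof. exact: pres_liftM (@adj_tperm_rel n) u v. Qed.

Lemma nu1 n : nu (1 : twin n) = 1.
Proof. by rewrite /nu -pres_cls0 (pres_lift_cls (@adj_tperm_rel n)). Qed.

Lemma nu_gen n (j : 'I_n.-1) : nu (twin_gen j) = adj_tperm j.
Proof. exact: (pres_lift_gen (@adj_tperm_rel n)). Qed.

Lemma nuV n (u : twin n) : nu u^-1 = (nu u)^-1.
Proof.
by apply: (mulgI (nu u)); rewrite -nuM !mulgV nu1.
Qed.

(* With 0-based indices for strands and generators, i <= n and j < n:
   s_i(t_j) = t_(j+1)       if i < j,
              t_(j+1) t_j   if i = j,
              t_j t_(j+1)   if i = j + 1,
              t_j           if i > j + 1. *)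
Definition double_gen (n : nat) (i : 'I_n.+1) (j : 'I_n.+1.-1) : twin n.+2 :=
  let t0 : twin n.+2 := twin_gen (widen_ord (leqnSn n) j : 'I_n.+2.-1) in
  let t1 : twin n.+2 := twin_gen (lift ord0 j : 'I_n.+2.-1) in
  if i < j then t1 else if i == j :> nat then t1 * t0
  else if i == j.+1 :> nat then t0 * t1 else t0.

(* The sign of a letter is irrelevant since t_j^-1 = t_j. *)
Fixpoint double_word (n : nat) (i : 'I_n.+1) (w : word 'I_n.+1.-1) : twin n.+2 :=
  if w is (j, _) :: w' then
    double_gen i j * double_word (adj_tperm j i) w'
  else 1.

Definition double_strand (n : nat) (i : 'I_n.+1) (u : twin n.+1) : twin n.+2 :=
  double_word i (repr u).

Lemma nu_cls n (w : word 'I_n.-1) :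
  nu (pres_cls (@twin_rel n) w) = word_eval (@adj_tperm n) w.
Proof. exact: (pres_lift_cls (@adj_tperm_rel n)). Qed.

Lemma double_word_cat n (i : 'I_n.+1) (u v : word 'I_n.+1.-1) :
  double_word i (u ++ v) =
  double_word i u * double_word ((word_eval (@adj_tperm n.+1) u : 'S_n.+1) i) v.
Proof.
elim: u i => [|[j b] u IHu] i /=; first by rewrite perm1 mul1g.
rewrite IHu mulgA permM; congr (_ * double_word ((word_eval _ u : 'S_n.+1) _) v).
by case: b; rewrite ?tpermV.
Qed.

(* t_(m+1), or 1 when m is out of range. *)
Definition tw n (m : nat) : twin n := if insub m is Some j then twin_gen j else 1.

Lemma twE n (j : 'I_n.-1) : twin_gen j = tw n j.
Proof. by rewrite /tw valK. Qed.

Lemma tw_sq n m : tw n m * tw n m = 1.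
Proof.
rewrite /tw; case: insubP => [j _ _|_]; [exact: twin_gen_sq | exact: mulg1].
Qed.

Lemma twC n m p : (m.+2 <= p) || (p.+2 <= m) -> tw n m * tw n p = tw n p * tw n m.
Proof.
rewrite /tw; case: insubP => [j _ <-|_]; last by rewrite mul1g mulg1.
by case: insubP => [k _ <-|_]; [exact: twin_genC | rewrite mul1g mulg1].
Qed.

Definition dw n (i j : nat) : twin n :=
  if i < j then tw n j.+1 else if i == j then tw n j.+1 * tw n j
  else if i == j.+1 then tw n j * tw n j.+1 else tw n j.

Lemma double_genE n (i : 'I_n.+1) (j : 'I_n.+1.-1) : double_gen i j = dw n.+2 i j.
Proof. by rewrite /double_gen /dw !twE. Qed.

Lemma dw1 n i j : i < j -> dw n i j = tw n j.+1.
Proof. by rewrite /dw => ->. Qed.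

Lemma dw2 n j : dw n j j = tw n j.+1 * tw n j.
Proof. by rewrite /dw ltnn eqxx. Qed.

Lemma dw3 n j : dw n j.+1 j = tw n j * tw n j.+1.
Proof. by rewrite /dw ltnNge leqnSn /= gtn_eqF // eqxx. Qed.

Lemma dw4 n i j : j.+1 < i -> dw n i j = tw n j.
Proof. by move=> ji; rewrite /dw ltnNge !gtn_eqF ?(ltnW ji) // ltnW // ltnW. Qed.

Lemma swap1 j : swap_nat j j = j.+1.
Proof. by rewrite /swap_nat eqxx. Qed.

Lemma swap2 j : swap_nat j j.+1 = j.
Proof. by rewrite /swap_nat gtn_eqF // eqxx. Qed.

Lemma swap3 j k : (k < j) || (j.+1 < k) -> swap_nat j k = k.
Proof. by rewrite /swap_nat => jk; do 2?case: eqP => //; lia. Qed.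

Lemma near_case (i j : nat) :
  [\/ i < j, i = j, i = j.+1 | j.+1 < i].
Proof.
case: (ltngtP i j) => [ij|ij|->]; [by constructor 1| |by constructor 2].
by case: (ltngtP i j.+1) => ij'; [lia|constructor 4|constructor 3].
Qed.

Lemma dw_sq n i j : dw n i j * dw n (swap_nat j i) j = 1.
Proof.
have sqK a b : tw n a * tw n b * (tw n b * tw n a) = 1.
  by rewrite -mulgA (mulgA (tw n b)) tw_sq mul1g tw_sq.
case: (near_case i j) => [ij|->|->|ij].
- by rewrite swap3 ?ij // dw1 ?tw_sq.
- by rewrite swap1 dw2 dw3 sqK.
- by rewrite swap2 dw2 dw3 sqK.
- by rewrite swap3 ?ij ?orbT // dw4 ?tw_sq.
Qed.

Lemma dw_comm n i j p : j.+2 <= p ->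
  dw n i j * dw n (swap_nat j i) p = dw n i p * dw n (swap_nat p i) j.
Proof.
move=> jp.
have C00 : tw n j * tw n p = tw n p * tw n j by apply: twC; lia.
have C01 : tw n j * tw n p.+1 = tw n p.+1 * tw n j by apply: twC; lia.
have C11 : tw n j.+1 * tw n p.+1 = tw n p.+1 * tw n j.+1 by apply: twC; lia.
case: (near_case i j) => ij.
- have ip : i < p by lia.
  by rewrite (swap3 (j := j)) ?ij // (swap3 (j := p)) ?ip // !dw1.
- have ip : i < p by lia.
  rewrite (swap3 (j := p)) ?ip //; subst i.
  by rewrite swap1 dw2 !dw1 // -mulgA C01 mulgA C11 mulgA.
- have ip : i < p by lia.
  have jp1 : j < p by lia.
  rewrite (swap3 (j := p)) ?ip //; subst i.
  by rewrite swap2 dw3 !dw1 // -mulgA C11 mulgA C01 mulgA.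
rewrite (swap3 (j := j)) ?ij ?orbT // (dw4 n ij).
case: (near_case i p) => ip.
- by rewrite (swap3 (j := p)) ?ip // dw1 // dw4.
- have jp1 : j.+1 < p.+1 by lia.
  by rewrite ip swap1 dw2 dw4 // mulgA C01 -mulgA C00 mulgA.
- by rewrite ip swap2 dw3 dw4 // mulgA C00 -mulgA C01 mulgA.
- by rewrite (swap3 (j := p)) ?ip ?orbT // !dw4.
Qed.

Lemma double_word_eq n (u v : word 'I_n.+1.-1) : pres_eq (@twin_rel n.+1) u v ->
  forall i : 'I_n.+1, double_word i u = double_word i v.
Proof.
have sq (j : 'I_n.+1.-1) b b' (i : 'I_n.+1) : double_word i [:: (j, b); (j, b')] = 1.
  by rewrite /= mulg1 !double_genE adj_tpermE dw_sq.
elim=> {u v} [//|u v _ IH i|u v w _ uv _ vw i|u u' v v' uu' IHu _ IHv i|x b i|u v uv i].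
- by rewrite IH.
- by rewrite uv vw.
- by rewrite !double_word_cat IHu IHv (word_eval_eq (@adj_tperm_rel n.+1) uu').
- exact: sq.
- case: uv => [j|j p]; first exact: sq.
  rewrite /= !mulg1 !double_genE !adj_tpermE.
  by case/orP=> jp; [exact: (@dw_comm n.+2 i j p jp) |
    exact: esym (@dw_comm n.+2 i p j jp)].
Qed.

Lemma double_cls n (i : 'I_n.+1) (w : word 'I_n.+1.-1) :
  double_strand i (pres_cls (@twin_rel n.+1) w) = double_word i w.
Proof. exact/double_word_eq/pres_reprK. Qed.

Lemma doubleM n (i : 'I_n.+1) (u v : twin n.+1) :
  double_strand i (u * v) = double_strand i u * double_strand (nu u i) v.
Proof.
elim/pres_ind: u => u; elim/pres_ind: v => v.
by rewrite -pres_clsM !double_cls double_word_cat nu_cls.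
Qed.

Lemma double_twin_gen n (i : 'I_n.+1) (j : 'I_n.+1.-1) :
  double_strand i (twin_gen j) = double_gen i j.
Proof. by rewrite double_cls /= mulg1. Qed.

Lemma double1 n (i : 'I_n.+1) : double_strand i (1 : twin n.+1) = 1.
Proof. by rewrite -pres_cls0 double_cls. Qed.

Lemma nu_tw n m (k : 'I_n) : m.+1 < n -> nu (tw n m) k = swap_nat m k :> nat.
Proof.
move=> mn; have mn' : m < n.-1 by lia.
by rewrite -[m]/(val (Ordinal mn')) -twE nu_gen adj_tpermE.
Qed.

Ltac nat_cases :=
  repeat match goal with
  | |- context [if ?b then _ else _] =>
    lazymatch b with
    | context [if _ then _ else _] => fail
    | _ => let E := fresh in case E: b
    end
  end; lia.

Lemma nu_double_gen n (i : 'I_n.+1) (j : 'I_n.+1.-1) :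
  nu (double_gen i j) =
  lift_perm (lift ord0 i) (lift ord0 (adj_tperm j i)) (adj_tperm j).
Proof.
have jn : j < n := ltn_ord j.
have nu2 a b (k : 'I_n.+2) : a < n.+1 -> b < n.+1 ->
    nu (tw n.+2 a * tw n.+2 b) k = swap_nat b (swap_nat a k) :> nat.
  by move=> an bn; rewrite nuM permM !nu_tw.
rewrite double_genE; apply/permP=> k; apply: ord_inj.
have -> : nat_of_ord (lift_perm (lift ord0 i) (lift ord0 (adj_tperm j i)) (adj_tperm j) k)
    = if k == i.+1 :> nat then (swap_nat j i).+1
      else bump (swap_nat j i).+1 (swap_nat j (unbump i.+1 k)).
  case: (unliftP (lift ord0 i) k) => [k'|] ->.
    rewrite lift_perm_lift /= !adj_tpermE.
    by rewrite -[bump 0 i]/i.+1 eq_sym (negbTE (neq_bump _ _)) bumpK.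
  by rewrite lift_perm_id /= adj_tpermE eqxx.
have jn1 : j < n.+1 by lia.
have jn2 : j.+1 < n.+1 by lia.
case: (near_case i j) => ij.
- rewrite dw1 // nu_tw // /swap_nat /bump /unbump.
  by nat_cases.
- rewrite ij dw2 nu2 // /swap_nat /bump /unbump.
  by nat_cases.
- rewrite ij dw3 nu2 // /swap_nat /bump /unbump.
  by nat_cases.
- rewrite dw4 // nu_tw // /swap_nat /bump /unbump.
  by nat_cases.
Qed.

Lemma nu_double n (i : 'I_n.+1) (u : twin n.+1) :
  nu (double_strand i u) = lift_perm (lift ord0 i) (lift ord0 (nu u i)) (nu u).
Proof.
elim/pres_ind: u => u; rewrite double_cls nu_cls.
elim: u i => [|[j b] u IHu] i /=; first by rewrite nu1 perm1 lift_perm1.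
have -> : (if b then adj_tperm j else (adj_tperm j)^-1) = adj_tperm j.
  by case: b; rewrite ?tpermV.
by rewrite nuM IHu permM nu_double_gen lift_permM.
Qed.

Definition pure (n : nat) : pred (twin n) := fun u => nu u == 1.

Lemma pure_closed n : group_closed (@pure n).
Proof.
split=> [|u v]; first by rewrite unfold_in /pure nu1.
by rewrite !unfold_in /pure nuM nuV => /eqP-> /eqP->; rewrite mulgV.
Qed.

Definition PT (n : nat) : Type := {u : twin n | pure u}.
HB.instance Definition _ n := SubChoice.on (PT n).
HB.instance Definition _ n :=
  SubChoice_isSubGroup.Build (twin n) (@pure n) (PT n) (@pure_closed n).

Definition SPT (n : nat) : groupType := PT n.+1.

Lemma pure_double n (i : 'I_n.+1) (u : SPT n) : pure (double_strand i (val u)).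
Proof. by rewrite /pure nu_double (eqP (valP u)) perm1 lift_perm1. Qed.

(* The degeneracy s_i : SPT_n -> SPT_(n+1), 0 <= i <= n *)
Definition degen (n : nat) (i : 'I_n.+1) (u : SPT n) : SPT n.+1 :=
  Sub (double_strand i (val u)) (pure_double i u).

Lemma degenM n (i : 'I_n.+1) (u v : SPT n) :
  degen i (u * v) = degen i u * degen i v.
Proof.
by apply: val_inj; rewrite /= doubleM (eqP (valP u)) perm1.
Qed.

Definition t1t2_cubed : twin 3 :=
  ((twin_gen (ord0 : 'I_3.-1)) * (twin_gen (ord_max : 'I_3.-1))) ^+ 3.

Lemma pure_t1t2_cubed : pure t1t2_cubed.
Proof.
apply/eqP/permP=> k; apply: ord_inj.
rewrite /t1t2_cubed !expgS !nuM !nu_gen nu1 mulg1 perm1; do 5!rewrite permM.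
rewrite !adj_tpermE.
by case: k => [[|[|[|]]]].
Qed.

Definition c111 : SPT 2 := Sub t1t2_cubed pure_t1t2_cubed.

(* Applies the degeneracies with indices in l, starting with the head of l; the
   dimension reached is tracked by the tag. *)
Definition degens (l : seq nat) (z : {n : nat & SPT n}) : {n : nat & SPT n} :=
  foldl (fun z k => Tagged SPT (degen (inord k) (tagged z))) z l.

(* The elements s_(n-1) .. ^s_j .. ^s_i .. s_0 (c111) for 0 <= i < j <= n - 1;
   all indices are in range, so that inord k is k at each step. *)
Definition K_gen (n : nat) (x : SPT n) : Prop :=
  exists i j : nat, i < j < n /\
    Tagged SPT x =
      degens [seq k <- iota 0 n | k \notin [:: i; j]] (Tagged SPT c111).

Definition K (n : nat) : groupType := generated (@K_gen n).

(* Delta[d]_n *)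
Definition simplex (d n : nat) : finType :=
  {f : {ffun 'I_n.+1 -> 'I_d.+1} |
    [forall i : 'I_n.+1, forall j : 'I_n.+1, (i <= j) ==> (f i <= f j)]}.

(* A simplex of Delta[d] is in the boundary iff it misses some vertex. *)
Definition in_boundary (d n : nat) (f : simplex d n) : bool :=
  [exists k, k \notin codom (val f)].

(* The n-simplices of Delta[2] / bd Delta[2]; None is the basepoint. *)
Definition S2 (n : nat) : finType := option {f : simplex 2 n | ~~ in_boundary f}.

(* F[X]_n for the pointed set (X, pt) of n-simplices *)
Definition milnor_F (X : choiceType) (pt : X) : groupType :=
  free_group {x : X | x != pt}.

Definition F_S2 (n : nat) : groupType := @milnor_F (S2 n) None.

(* Main.v *)
Require Import Defs.
From HB Require Import structures.
From mathcomp Require Import all_boot perm.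
From mathcomp Require Import boolp.
From mathcomp Require Import zify.

Set Implicit Arguments.
Unset Strict Implicit.
Unset Printing Implicit Defensive.

Local Open Scope group_scope.

(** K_n is free on its generators for every n, because PT_(n+1) has a
homomorphism to a free group that sends these generators to a basis. This
homomorphism watches the leftmost strand only. Number the strands 0, .., n by
their starting positions. Reading a twin from top to bottom, the strand in the
leftmost position changes exactly at the crossings t_1, and recording these
changes gives a path in the complete graph on the strands: a crossing t_1 where
strand a is replaced by strand b on the left is recorded as the edge from a to
b. The relation t_1^2 = 1 only removes a backtracking a, b, a, and the other
relations do not change the path at all, since a generator commuting with t_1
does not move the two leftmost strands. A pure twin gives a closed path at
strand 0, so PT_(n+1) maps to the fundamental group of the complete graph. That
group is free on the loops 0, b, c, 0 with 0 < b < c <= n, because the edges at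
0 form a spanning tree.

The generator of K_n with parameters i < j is c_111 with its three strands
replaced by ribbons of parallel strands, starting at strands 0, i+1 and j+1.
The leftmost strand of a ribbon is always its first one ([lead_double]), and
the path of c_111 is 0, 1, 2, 0 ([lead_t1t2_cubed]); hence this generator is
sent to the loop 0, i+1, j+1, 0 ([lead_cable]), that is, to a basis element
([edge_loop]). A homomorphism sending a generating family to a basis of a free
group shows that the family is itself a free basis ([free_on_basis]). Finally,
the pairs i < j < n index the n-simplices of S^2 other than the basepoint,
which are the monotone maps from {0, .., n} onto {0, 1, 2}, through the two
places where such a map increases ([cut_gen_inj], [cut_gen_surj]). *)

(** * A criterion for freeness *)

(** The map [f] undoes on words the evaluation of the free group at [g], so no
nontrivial word in the [g x] is trivial. *)
Lemma free_on_basis (X : choiceType) (G : groupType) (S : G -> Prop)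
    (g : X -> G) (f : G -> free_group X) :
    {morph f : u v / u * v} -> (forall x, S (g x)) ->
    (forall y, S y -> exists x, g x = y) ->
    (forall x, f (g x) = pres_gen (fun _ _ => False) x) ->
  isomorphic (generated S) (free_group X).
Proof.
move=> fM Sg gS fg.
have gK x : gen_mem S (g x) by apply/asboolP => H _; apply.
pose g' x : generated S := Sub (g x) (gK x).
pose h : free_group X -> generated S := pres_lift g'.
have hM u v : h (u * v) = h u * h v by exact: pres_liftM.
have h1 : h 1 = 1 by apply: (mulgI (h 1)); rewrite -hM !mulg1.
pose f' (a : generated S) := f (val a).
have f'M : {morph f' : a b / a * b} by move=> a b; rewrite /f' /= fM.
have f1 : f' 1 = 1 by apply: (mulgI (f' 1)); rewrite -f'M !mulg1.
have f'V a : f' a^-1 = (f' a)^-1.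
  by apply: (mulgI (f' a)); rewrite -f'M !mulgV f1.
have hK : cancel h f'.
  elim/pres_ind=> u; rewrite /h pres_lift_cls //.
  elim: u => [|[x b] u IHu] /=; first by rewrite f1 pres_cls0.
  rewrite f'M IHu -cat1s pres_clsM pres_cls1; congr (_ * _).
  by case: b; rewrite ?f'V /f' /= fg.
have hV u : h u^-1 = (h u)^-1.
  by apply: (mulgI (h u)); rewrite -hM !mulgV h1.
pose H : {pred G} := fun y => `[< exists u, val (h u) = y >].
have HG : group_closed H.
  split=> [|x y /asboolP[u <-] /asboolP[v <-]]; apply/asboolP.
    by exists 1; rewrite h1.
  by exists (u * v^-1); rewrite hM hV.
(* The image of h is a subgroup containing S, hence everything. *)
have hS (a : generated S) : exists u, h u = a.
  suff /asboolP[u hu] : val a \in H by exists u; apply: val_inj.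
  have /asboolP := valP a; apply=> // y /gS[x <-]; apply/asboolP.
  by exists (pres_gen (fun _ _ => False) x); rewrite /h pres_lift_gen.
have f'K : cancel f' h by move=> a; have [u <-] := hS a; rewrite hK.
pose fm := isMultiplicative.Build _ _ f' f'M.
pose F : {multiplicative generated S -> free_group X} := HB.pack f' fm.
by exists F; exists h.
Qed.

(** * Following the leftmost strand *)

(** The next four identities describe the effect of doubling strand [i] in the
crossing t_(j+1), one for each formula for s_i (t_(j+1)): [bump i.+1] sends a
strand to the first of its copies, and the number of the doubled strand becomes
[swap_nat j i] below the crossing. *)
Lemma bump_swap_lt (i j a : nat) : i < j ->
  swap_nat j.+1 (bump (swap_nat j i).+1 a) = bump i.+1 (swap_nat j a).
Proof. by move=> ij; rewrite (@swap3 j i) ?ij // /swap_nat /bump; nat_cases. Qed.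

Lemma bump_swap_eq (j a : nat) :
  swap_nat j.+1 (swap_nat j (bump (swap_nat j j).+1 a)) =
  bump j.+1 (swap_nat j a).
Proof. rewrite swap1 /swap_nat /bump; nat_cases. Qed.

Lemma bump_swap_succ (j a : nat) :
  swap_nat j (swap_nat j.+1 (bump (swap_nat j j.+1).+1 a)) =
  bump j.+2 (swap_nat j a).
Proof. rewrite swap2 /swap_nat /bump; nat_cases. Qed.

Lemma bump_swap_gt (i j a : nat) : j.+1 < i ->
  swap_nat j (bump (swap_nat j i).+1 a) = bump i.+1 (swap_nat j a).
Proof.
by move=> ij; rewrite (@swap3 j i) ?ij ?orbT // /swap_nat /bump; nat_cases.
Qed.

Section Lead.
Variable G : groupType.
Implicit Types e : nat -> nat -> G.

(** [e a b] is the value given to the leftmost position passing from strand [a]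
to strand [b]; being [skew] makes backtracking trivial. *)
Definition skew e := forall a b, e a b * e b a = 1.

Definition pull (p : nat -> nat) e : nat -> nat -> G := fun a b => e (p a) (p b).

Lemma skew_pull p e : skew e -> skew (pull p e).
Proof. by move=> He a b; apply: He. Qed.

(** Instead of carrying along the arrangement of the strands, the labelling [e]
is pulled back at each letter, so that it is always indexed by the current
positions; the leftmost position then always passes from 0 to 1. *)
Fixpoint lead_word m e (w : word 'I_m) : G :=
  if w is (j, _) :: w' then
    (if j == 0%N :> nat then e 0%N 1%N else 1) * lead_word (pull (swap_nat j) e) w'
  else 1.

(** The strand in position [a] below [w] is the one starting in position
[source w a] above it. *)
Definition source m (w : word 'I_m) : nat -> nat :=
  fun a => foldr (fun (l : 'I_m * bool) => swap_nat l.1) a w.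

Lemma lead_word_cat m e (u v : word 'I_m) :
  lead_word e (u ++ v) = lead_word e u * lead_word (pull (source u) e) v.
Proof.
elim: u e => [|[j b] u IHu] e /=; first by rewrite mul1g.
by rewrite IHu mulgA.
Qed.

Lemma swap_natK j : involutive (swap_nat j).
Proof. by move=> k; rewrite /swap_nat; repeat case: eqP => //; lia. Qed.

Lemma swap_natC i j a : i.+2 <= j ->
  swap_nat i (swap_nat j a) = swap_nat j (swap_nat i a).
Proof. by move=> ij; rewrite /swap_nat; repeat case: eqP => //; lia. Qed.

(** The two claims have to be proved together: in a concatenation the second
factor is read through the [source] of the first. *)
Lemma lead_word_eq n (u v : word 'I_n.-1) : pres_eq (@twin_rel n) u v ->
  source u = source v /\ forall e, skew e -> lead_word e u = lead_word e v.
Proof.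
have sq (j : 'I_n.-1) b b' : source [:: (j, b); (j, b')] = source [::] /\
    forall e, skew e -> lead_word e [:: (j, b); (j, b')] = 1.
  split=> [|e He]; first by apply: funext => a; rewrite /source /= swap_natK.
  rewrite /= mulg1 /pull; case: eqP => [-> |_]; last exact: mulg1.
  exact: He.
have comm (i j : 'I_n.-1) : i.+2 <= j ->
    let u := [:: (i, true); (j, true)] in let v := [:: (j, true); (i, true)] in
    source u = source v /\ forall e, skew e -> lead_word e u = lead_word e v.
  move=> ij /=; split=> [|e _].
    by apply: funext => a; rewrite /source /= swap_natC.
  rewrite !mulg1 /pull; have -> : (j == 0%N :> nat) = false by lia.
  rewrite mulg1 mul1g; case: eqP => // i0.
  by rewrite /swap_nat; repeat case: eqP => //; lia.
elim=> {u v} [//|u v _ [-> uv]|u v w _ [-> uv] _ [-> vw]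
             |u u' v v' _ [uu' lu] _ [vv' lv]|x b|u v].
- by split=> // e He; rewrite uv.
- by split=> // e He; rewrite uv // vw.
- split=> [|e He]; first by rewrite /source; apply: funext => a;
    rewrite !foldr_cat -/(source v a) -/(source v' a) vv' -/(source u _) uu'.
  by rewrite !lead_word_cat lu // uu' lv //; apply: skew_pull.
- exact: sq.
- case=> [i|i j /orP[] ij]; [exact: sq | exact: comm |].
  by have [E1 E2] := comm _ _ ij; split=> [|e He]; rewrite ?E1 ?E2.
Qed.

Definition lead n e (u : twin n) : G := lead_word e (repr u).

Lemma lead_cls n e (w : word 'I_n.-1) : skew e ->
  lead e (pres_cls (@twin_rel n) w) = lead_word e w.
Proof.
by move=> He; have [_] := lead_word_eq (pres_reprK (@twin_rel n) w); apply.
Qed.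

Lemma lead1 n e : skew e -> lead e (1 : twin n) = 1.
Proof. by move=> He; rewrite -pres_cls0 lead_cls. Qed.

Lemma lead_twM n e m (u : twin n) : skew e -> m < n.-1 ->
  lead e (tw n m * u) =
  (if m == 0%N then e 0%N 1%N else 1) * lead (pull (swap_nat m) e) u.
Proof.
move=> He mn; elim/pres_ind: u => u.
rewrite -[m]/(val (Ordinal mn)) -twE -pres_clsM !lead_cls //.
exact: skew_pull.
Qed.

Lemma source_nu n (w : word 'I_n.-1) (k : 'I_n) :
  source w (nu (pres_cls (@twin_rel n) w) k) = k.
Proof.
rewrite nu_cls; elim: w k => [|[j b] w IHw] k /=; first by rewrite perm1.
rewrite permM (_ : (if b then adj_tperm j else _) = adj_tperm j).
  by rewrite IHw adj_tpermE swap_natK.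
by case: b; rewrite ?tpermV.
Qed.

Lemma source_out n (w : word 'I_n.-1) a : n <= a -> source w a = a.
Proof.
move=> na; elim: w => [|[j b] w IHw] //=; rewrite [source _ _]/=.
have := ltn_ord j.
by rewrite -/(source w a) IHw /swap_nat; repeat case: eqP; lia.
Qed.

(** Below a pure twin every strand is back in its starting position, so the
second factor is read with the same labelling. *)
Lemma lead_pureM n e (u v : twin n) : skew e -> nu u = 1 ->
  lead e (u * v) = lead e u * lead e v.
Proof.
move=> He; elim/pres_ind: u => u; elim/pres_ind: v => v nu1.
rewrite -pres_clsM !lead_cls // lead_word_cat; congr (_ * lead_word _ v).
suff Hu a : source u a = a by apply: funext => a; apply: funext => b; rewrite /pull !Hu.
have [an|/source_out //] := ltnP a n.
by have := source_nu u (Ordinal an); rewrite nu1 perm1.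
Qed.

(** Two parallel copies of a strand do not cross, so the leftmost position is
never occupied by the second copy: the path of the doubled twin is the path of
[u] with each strand replaced by its first copy. *)
Lemma lead_double n e (i : 'I_n.+1) (u : twin n.+1) : skew e ->
  lead e (double_strand i u) = lead (pull (bump i.+1) e) u.
Proof.
move=> He; elim/pres_ind: u => u.
rewrite double_cls lead_cls; last exact: skew_pull.
elim: u i e He => [|[j b] u IHu] i e He /=; first exact: lead1.
have jn : j < n := ltn_ord j.
have eqp (p q : nat -> nat) : p =1 q -> pull p e = pull q e by move=> /funext->.
rewrite double_genE; case: (near_case i j) => ij.
- rewrite dw1 // lead_twM ?ltnS // IHu ?adj_tpermE; last exact: skew_pull.
  have -> : (j == 0%N :> nat) = false by lia.
  by congr (_ * lead_word _ u); apply: eqp => a; exact: bump_swap_lt.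
(* The doubled strand sits on the left of the crossing: for j = 0 the leftmost
   position passes from its first copy 0 directly to 2. *)
- rewrite ij dw2 -mulgA !lead_twM ?ltnS //; try by [lia | exact: skew_pull].
  rewrite IHu ?adj_tpermE; last by do 2!apply: skew_pull.
  rewrite mul1g ij; congr (_ * lead_word _ u); first by case: eqP => // ->.
  by apply: eqp => a; exact: bump_swap_eq.
- rewrite ij dw3 -mulgA !lead_twM ?ltnS //; try by [lia | exact: skew_pull].
  rewrite IHu ?adj_tpermE; last by do 2!apply: skew_pull.
  rewrite mul1g ij; congr (_ * lead_word _ u).
  by apply: eqp => a; exact: bump_swap_succ.
- rewrite dw4 // lead_twM //; last lia.
  rewrite IHu ?adj_tpermE; last exact: skew_pull.
  congr (_ * lead_word _ u); last by apply: eqp => a; exact: bump_swap_gt.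
  case: eqP => // j0; have i1 : 1 < i by move: ij; rewrite j0.
  by case: (nat_of_ord i) i1 => [|[|k]].
Qed.

Lemma lead_t1t2_cubed e : skew e ->
  lead e t1t2_cubed = e 0%N 1%N * e 1%N 2%N * e 2%N 0%N.
Proof.
move=> He; rewrite /t1t2_cubed !twE !expgS expg0.
rewrite -!mulgA.
do 6!(rewrite lead_twM //; try by do !apply: skew_pull).
by rewrite lead1 ?mul1g ?mulg1 //; do ?apply: skew_pull.
Qed.

(** The hypothesis says that each degeneracy in [l] exists in the dimension
where it is applied. *)
Lemma lead_degens e (l : seq nat) (z : {n : nat & SPT n}) : skew e ->
    (forall m, m < size l -> nth 0%N l m <= tag z + m) ->
  tag (degens l z) = tag z + size l :> nat /\
  lead e (val (tagged (degens l z))) =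
  lead (pull (fun a => foldl (fun a k => bump k.+1 a) a l) e) (val (tagged z)).
Proof.
move=> He; elim: l z => [|k l IHl] z Hl /=; first by rewrite addn0.
have [m|E1 E2] := IHl (Tagged SPT (degen (inord k) (tagged z))).
  by move=> ml; have := Hl m.+1 ml; rewrite /= addnS.
split; first by rewrite E1 /= addSnnS.
rewrite -/(degens l _) E2 /=.
rewrite lead_double; last exact: skew_pull.
by rewrite inordK // ltnS; have := Hl 0%N isT; rewrite /= addn0.
Qed.

End Lead.

(** * The generators of K_n *)

Definition skip2 i j n : seq nat :=
  iota 0 i ++ iota i.+1 (j - i.+1) ++ iota j.+1 (n - j.+1).

Lemma filter_skip2 i j n : i < j < n ->
  [seq k <- iota 0 n | k \notin [:: i; j]] = skip2 i j n.
Proof.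
move=> ijn; have keep m d : (i \notin iota m d) -> (j \notin iota m d) ->
    [seq k <- iota m d | k \notin [:: i; j]] = iota m d.
  move=> im jm; apply/all_filterP/allP => k km; rewrite !inE negb_or.
  by apply/andP; split; [apply: contraNneq im | apply: contraNneq jm] => <-.
have -> : n = (i + ((j - i.+1) + (n - j.+1).+1).+1)%N by lia.
rewrite /skip2 iotaD filter_cat /= iotaD filter_cat /=.
rewrite (_ : i.+1 + (j - i.+1) = j)%N; last lia.
rewrite !inE !eqxx orbT /= !add0n.
by rewrite !keep ?mem_iota; try congr (_ ++ (_ ++ iota _ _)); lia.
Qed.

Lemma size_skip2 i j n : i < j < n -> size (skip2 i j n) = (n - 2)%N.
Proof. by move=> ijn; rewrite !size_cat !size_iota; lia. Qed.

Lemma nth_skip2 i j n m : i < j < n -> m < size (skip2 i j n) ->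
  nth 0%N (skip2 i j n) m <= 2 + m.
Proof.
move=> ijn; rewrite size_skip2 // => mn.
rewrite !nth_cat !size_iota; case: ifP => mi; first by rewrite nth_iota; lia.
by case: ifP => mj; rewrite nth_iota; lia.
Qed.

(** The face map of vertices dual to the degeneracies in [l]: the number of the
first copy of strand [a] after all these doublings. *)
Definition codeg (l : seq nat) (a : nat) : nat :=
  foldl (fun a k => bump k.+1 a) a l.

Lemma codeg_cat l l' a : codeg (l ++ l') a = codeg l' (codeg l a).
Proof. exact: foldl_cat. Qed.

Lemma codeg_fix l a : all (leq a) l -> codeg l a = a.
Proof.
elim: l => //= k l IHl /andP[ak al].
by rewrite /codeg /= /bump ltnNge ak /= -/(codeg l a) IHl.
Qed.

Lemma codeg_iota m d a : codeg (iota m d) (a.+1 + m)%N = (a.+1 + m + d)%N.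
Proof.
elim: d m => [|d IHd] m /=; first by rewrite addn0.
rewrite /codeg /= /bump addSn ltnS leq_addl add1n -addnS -addSn.
by rewrite -/(codeg _ _) IHd !addnS !addSn.
Qed.

(** A strand moves up by one at each doubling whose index is smaller than
its current number. Strand 1 is pushed along until the first omitted index [i];
strand 2 survives this omission and is pushed along until [j]. *)
Lemma codeg_skip2 i j n : i < j < n ->
  [/\ codeg (skip2 i j n) 0 = 0%N, codeg (skip2 i j n) 1 = i.+1
    & codeg (skip2 i j n) 2 = j.+1].
Proof.
move=> ijn; rewrite !codeg_cat.
have fix_iota a m d : a <= m -> codeg (iota m d) a = a.
  by move=> am; apply/codeg_fix/allP => k; rewrite mem_iota /=; lia.
have E a : codeg (iota 0 i) a.+1 = (a.+1 + i)%N.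
  by have := codeg_iota 0 i a; rewrite addn0.
split; first by rewrite !fix_iota.
  by rewrite E !fix_iota //; lia.
by rewrite E addSnnS codeg_iota fix_iota; lia.
Qed.

(** [x] is c_111 with its strands replaced by ribbons of i+1, j-i and n-j
parallel strands. *)
Definition is_cable n (i j : nat) (x : SPT n) : Prop :=
  Tagged SPT x =
    degens [seq k <- iota 0 n | k \notin [:: i; j]] (Tagged SPT c111).

Lemma lead_cable (G : groupType) (e : nat -> nat -> G) n i j (x : SPT n) :
    skew e -> i < j < n -> is_cable i j x ->
  lead e (val x) = e 0%N i.+1 * e i.+1 j.+1 * e j.+1 0%N.
Proof.
move=> He ijn; rewrite /is_cable filter_skip2 // => Ex.
have [m mn|_] := @lead_degens _ e (skip2 i j n) (Tagged SPT c111) He.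
  exact: nth_skip2.
rewrite -Ex lead_t1t2_cubed; last exact: skew_pull.
by have [E0 E1 E2] := codeg_skip2 ijn; rewrite /pull -!/(codeg _ _) E0 E1 E2.
Qed.

(** The iterated degeneracy lives in a dimension that is only provably equal to
[n]. *)
Lemma cable_exists n i j : i < j < n -> exists x : SPT n, is_cable i j x.
Proof.
move=> ijn; rewrite /is_cable filter_skip2 //.
(* Only the dimension is wanted here, so any labelling will do. *)
have skew1 : skew (fun _ _ : nat => 1 : twin 0) by move=> ? ?; rewrite mulg1.
have [m mn|] := @lead_degens _ _ (skip2 i j n) (Tagged SPT c111) skew1.
  exact: nth_skip2.
rewrite size_skip2 //= => E _.
have {E} : tag (degens (skip2 i j n) (Tagged SPT c111)) = n by rewrite E; lia.
by case: degens => m x /= mn; case: n / mn ijn => _; exists x.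
Qed.

Lemma cable_inj n i j (x y : SPT n) : is_cable i j x -> is_cable i j y -> x = y.
Proof.
move=> Ex Ey; have : Tagged SPT x == Tagged SPT y by rewrite Ex Ey.
by rewrite eq_Tagged => /eqP.
Qed.

(** * The simplices of the 2-sphere *)

(** A pair i < j of places where a monotone map onto {0, 1, 2} increases: from
[i] to [i.+1], and from [j] to [j.+1]. *)
Definition cut n : choiceType := {p : 'I_n * 'I_n | p.1 < p.2}.

Lemma cutP n (p : cut n) : (val p).1 < (val p).2 < n.
Proof. by rewrite (valP p) /= ltn_ord. Qed.

Definition cut_fun n (p : cut n) : {ffun 'I_n.+1 -> 'I_3} :=
  [ffun k : 'I_n.+1 => inord (((val p).1 < k) + ((val p).2 < k))].

Lemma cut_funE n (p : cut n) k :
  cut_fun p k = ((val p).1 < k) + ((val p).2 < k) :> nat.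
Proof. by rewrite ffunE inordK //; lia. Qed.

Lemma cut_mono n (p : cut n) :
  [forall i : 'I_n.+1, forall j : 'I_n.+1, (i <= j) ==> (cut_fun p i <= cut_fun p j)].
Proof.
apply/forallP => i; apply/forallP => j; apply/implyP => ij.
by rewrite !cut_funE; lia.
Qed.

Definition cut_simplex n (p : cut n) : simplex 2 n := Sub (cut_fun p) (cut_mono p).

Lemma cut_interior n (p : cut n) : ~~ in_boundary (cut_simplex p).
Proof.
have ijn := cutP p; apply/existsPn => k; rewrite negbK.
have hit (v : nat) : cut_fun p (inord v) = k :> nat ->
    k \in codom (cut_fun p).
  by move=> E; apply/codomP; exists (inord v); apply: val_inj.
have k3 := ltn_ord k; rewrite /=.
have [k0|k1|k2] : [\/ k = 0%N :> nat, k = 1%N :> nat | k = 2%N :> nat].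
  by case: (nat_of_ord k) k3 => [|[|[]]]; [constructor 1|constructor 2|constructor 3|].
- by apply: (hit 0%N) => //; rewrite cut_funE inordK // k0 !ltn0.
- by apply: (hit (val p).2) => //; rewrite ?cut_funE ?inordK ?k1; lia.
- by apply: (hit n) => //; rewrite ?cut_funE ?inordK ?k2; lia.
Qed.

Definition S2_gen n : choiceType := {x : S2 n | x != None}.

Definition cut_gen n (p : cut n) : S2_gen n :=
  Sub (Some (Sub (cut_simplex p) (cut_interior p))) isT.

Lemma cut_gen_inj n : injective (@cut_gen n).
Proof.
move=> p q /(congr1 val)[E].
have E' k : cut_fun p k = cut_fun q k by rewrite E.
have H v : v < n.+1 -> ((val p).1 < v) + ((val p).2 < v) =
   ((val q).1 < v) + ((val q).2 < v).
  by move=> vn; have := E' (inord v) => /(congr1 val) /=;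
    rewrite !cut_funE inordK.
case: p q E E' H => [[a b] /= ab] [[c d] /= cd] _ _ H.
apply: val_inj => /=; move: ab cd; rewrite /= => ab cd.
have [an bn] := (ltn_ord a, ltn_ord b); have [cn dn] := (ltn_ord c, ltn_ord d).
have Ha := H a.+1; have Hb := H b.+1; have Hc := H c.+1; have Hd := H d.+1.
by congr (_, _); apply: val_inj => /=; lia.
Qed.

Lemma cut_gen_surj n (x : S2_gen n) : exists p, cut_gen p == x.
Proof.
case: x => [[[f fi]|] //] xN.
case: f fi xN => f fm fi xN.
have mono (a b : 'I_n.+1) : a <= b -> f a <= f b.
  by move=> ab; have /forallP/(_ a)/forallP/(_ b)/implyP := fm; apply.
have onto (v : nat) : v < 3 -> exists a : 'I_n.+1, f a = v :> nat.
  move=> v3; have /existsPn/(_ (Ordinal v3)) := fi; rewrite negbK.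
  by case/codomP => a E; exists a; rewrite -[v]/(val (Ordinal v3)) E.
have [a0 f0] := onto 0%N isT; have [a1 f1] := onto 1%N isT.
have [a2 f2] := onto 2%N isT.
have ex v : v <= 2 -> exists m, v <= f (inord m).
  by move=> v2; exists a2; rewrite inord_val f2.
(* b and c are the least arguments where f reaches 1 and 2. *)
have [b fb minb] := ex_minnP (ex 1%N isT).
have [c fc minc] := ex_minnP (ex 2%N isT).
have bE (k : 'I_n.+1) : (b <= k) = (1 <= f k).
  apply/idP/idP => [bk|]; last by rewrite -{1}[k]inord_val => /minb.
  by apply: leq_trans fb (mono _ _ _); rewrite inordK //; have := ltn_ord k; lia.
have cE (k : 'I_n.+1) : (c <= k) = (2 <= f k).
  apply/idP/idP => [ck|]; last by rewrite -{1}[k]inord_val => /minc.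
  by apply: leq_trans fc (mono _ _ _); rewrite inordK //; have := ltn_ord k; lia.
have := bE a0; have := bE a1; have := cE a1; have := cE a2.
rewrite f0 f1 f2 /= => ca2 ca1 ba1 ba0; have a2n := ltn_ord a2.
have bn : b.-1 < n by lia.
have cn : c.-1 < n by lia.
have bc : (Ordinal bn, Ordinal cn).1 < (Ordinal bn, Ordinal cn).2 by rewrite /=; lia.
exists (Sub (Ordinal bn, Ordinal cn) bc); apply/eqP; apply: val_inj => /=.
congr Some; apply: val_inj => /=; apply: val_inj => /=; apply/ffunP => k.
apply: val_inj; rewrite /= cut_funE /=.
have := bE k; have := cE k; have := ltn_ord (f k).
by move: (nat_of_ord (f k)) (nat_of_ord k) => v w; lia.
Qed.

(** * The fundamental group of the complete graph *)

Section Chords.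
Variables (n : nat) (G : groupType) (g : cut n -> G).

(** The edges at strand 0 form the spanning tree and get the value 1; the edge
from i+1 to j+1 gets the value of the loop that it closes. *)
Definition chord (a b : nat) : G :=
  if [pick p : cut n | ((val p).1.+1 == a) && ((val p).2.+1 == b)] is Some p
  then g p else 1.

Definition edge (a b : nat) : G := chord a b * (chord b a)^-1.

Lemma edge_skew : skew edge.
Proof. by move=> a b; rewrite /edge mulgA mulgVK mulgV. Qed.

Lemma chord_le a b : b <= a -> chord a b = 1.
Proof.
move=> ba; rewrite /chord; case: pickP => // p /andP[/eqP pa /eqP pb].
by have := cutP p; lia.
Qed.

Lemma chord0 b : chord 0 b = 1.
Proof. by rewrite /chord; case: pickP. Qed.

Lemma chordE (p : cut n) : chord (val p).1.+1 (val p).2.+1 = g p.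
Proof.
rewrite /chord; case: pickP => [q|/(_ p)]; last by rewrite !eqxx.
rewrite !eqSS => /andP[/eqP E1 /eqP E2]; congr g; apply: val_inj.
by case: (val q) (val p) E1 E2 => [a b] [c d] /= /val_inj-> /val_inj->.
Qed.

Lemma edge_loop (p : cut n) (i := (val p).1) (j := (val p).2) :
  edge 0 i.+1 * edge i.+1 j.+1 * edge j.+1 0 = g p.
Proof.
have := cutP p => ij; rewrite /edge !chord0 (chord_le (leq0n i.+1)).
rewrite (chord_le (leq0n j.+1)) (@chord_le j.+1 i.+1) ?chordE; last first.
  by rewrite /i /j; lia.
by rewrite !invg1 !mulg1 mul1g.
Qed.

End Chords.

(** * Freeness *)

Theorem K_free n : isomorphic (K n) (F_S2 n).
Proof.
pose cutof (x : S2_gen n) : cut n := xchoose (cut_gen_surj x).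
have cutofK x : cut_gen (cutof x) = x by exact/eqP/(xchooseP (cut_gen_surj x)).
have cut_genK p : cutof (cut_gen p) = p by apply: cut_gen_inj; rewrite cutofK.
pose cable p : SPT n := sval (cid (cable_exists (cutP p))).
have cableP (p : cut n) : is_cable (val p).1 (val p).2 (cable p) by rewrite /cable; case: cid.
pose gen p : F_S2 n := pres_gen (fun _ _ => False) (cut_gen p).
have sk := edge_skew gen.
apply: (@free_on_basis (S2_gen n) (SPT n) (@K_gen n) (cable \o cutof)
   (fun u => lead (edge gen) (val u))).
- by move=> u v; rewrite /= lead_pureM //; apply/eqP/(valP u).
- move=> x; exists (val (cutof x)).1, (val (cutof x)).2; split; first exact: cutP.
  exact: cableP.
- move=> y [i [j [ijn Ey]]].
  have i_n : i < n by lia.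
  have j_n : j < n by lia.
  have ij : (Ordinal i_n, Ordinal j_n).1 < (Ordinal i_n, Ordinal j_n).2.
    by rewrite /=; lia.
  exists (cut_gen (Sub (Ordinal i_n, Ordinal j_n) ij)); rewrite /= cut_genK.
  by apply: cable_inj Ey; apply: cableP.
- by move=> x; rewrite /= (lead_cable sk (cutP _) (cableP _)) edge_loop /gen cutofK.
Qed.

Theorem theorem6p6 :
  isomorphic (K 3) (F_S2 3) /\ isomorphic (K 4) (F_S2 4).
Proof. by split; apply: K_free. Qed.
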